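(* For all $n\ge 0$, $a_n^{(3,2)}(0)=F_{2n+2}$, $a_n^{(4,2)}(0)=A007070(n)$ and $a_n^{(5,2)}(0)=A200676(n+3)$.
   Context: For integers $k,s\ge 1$ and $n\ge 0$, $a_n^{(k,s)}(0)$ denotes the number of words $\rho_1\cdots\rho_n\in\{1,\dots,k\}^n$ such that $\rho_{i+1}-\rho_i\ne s$ for all $1\le i\le n-1$ (so $a_0^{(k,s)}(0)=1$). $F_n$ is the Fibonacci sequence: $F_0=0$, $F_1=1$, $F_n=F_{n-1}+F_{n-2}$ for $n\ge 2$. $A007070$ and $A200676$ are sequences (indexed from $n=0$) of the On-Line Encyclopedia of Integer Sequences, with generating functions $$\sum_{n\ge 0}A007070(n)x^n=\frac{1}{1-4x+2x^2},\qquad \sum_{n\ge 0}A200676(n)x^n=\frac{1-5x+3x^2}{1-5x+3x^2-x^3}.$$ *)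

(* Defs.v *)
From mathcomp Require Import all_boot all_order all_algebra.

Set Implicit Arguments.
Unset Strict Implicit.
Unset Printing Implicit Defensive.

Import Order.TTheory GRing.Theory Num.Theory.
Local Open Scope ring_scope.

(* The element i of 'I_k encodes the letter i + 1 of {1, ..., k}. *)
Definition letter (k : nat) (i : 'I_k) : int := i.+1%:Z.

(* [sorted r w] only relates adjacent letters of w. *)
Definition num_words (k s n : nat) : nat :=
  #|[set w : n.-tuple 'I_k |
       sorted (fun x y => letter y - letter x != s%:Z) w]|.

Fixpoint fib (n : nat) : nat :=
  (match n with
   | 0 => 0
   | 1 => 1
   | (m.+1 as p).+1 => fib p + fib m
   end)%N.

(* Q(x) * \sum_n u(n) x^n = P(x) in Z[[x]], coefficient by coefficient: the
   generating function of u is P / Q. *)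
Definition has_ogf (u : nat -> int) (P Q : {poly int}) : Prop :=
  forall n : nat, \sum_(i < n.+1) Q`_i * u (n - i)%N = P`_n.

(* Coefficient of x^n in the expansion of P / Q in Z[[x]] when Q(0) = 1, from
   1 / Q = \sum_i (1 - Q)^i, whose terms with i > n vanish modulo x^(n+1). *)
Definition ogf_coef (P Q : {poly int}) (n : nat) : int :=
  (P * \sum_(i < n.+1) (1 - Q) ^+ i)`_n.

Lemma coef_exp_small (R : {poly int}) (i n : nat) :
  R`_0 = 0 -> (n < i)%N -> (R ^+ i)`_n = 0.
Proof.
move=> R0; elim: i n => // i IHi n; rewrite ltnS => lt_ni.
rewrite exprS coefM big1 // => -[[|j] ltj] _ /=; first by rewrite R0 mul0r.
by rewrite IHi ?mulr0 //; case: n lt_ni ltj => // n lt_ni _; rewrite subSS;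
   apply: leq_ltn_trans lt_ni; rewrite leq_subr.
Qed.

Lemma ogf_coef_widen (P Q : {poly int}) (n m : nat) :
  Q`_0 = 1 -> (n <= m)%N ->
  ogf_coef P Q n = (P * \sum_(i < m.+1) (1 - Q) ^+ i)`_n.
Proof.
move=> Q0 le_nm; rewrite /ogf_coef !coefM; apply: eq_bigr => j _.
congr (_ * _); rewrite !coef_sum.
rewrite (big_ord_widen m.+1 (fun i : nat => ((1 - Q) ^+ i)`_(n - j))) //.
rewrite big_mkcond; apply: eq_bigr => i _; case: ifP => // /negbT.
rewrite -leqNgt => lt_ni; rewrite coef_exp_small //.
  by rewrite coefB coef1 Q0 subrr.
by apply: leq_ltn_trans lt_ni; rewrite leq_subr.
Qed.

Lemma ogf_coefP (P Q : {poly int}) : Q`_0 = 1 -> has_ogf (ogf_coef P Q) P Q.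
Proof.
move=> Q0 n; set S := \sum_(i < n.+1) (1 - Q) ^+ i.
have -> : \sum_(i < n.+1) Q`_i * ogf_coef P Q (n - i) = (Q * (P * S))`_n.
  rewrite coefM; apply: eq_bigr => i _.
  by rewrite (ogf_coef_widen P Q0 (leq_subr i n)).
have QS : Q * S = 1 - (1 - Q) ^+ n.+1.
  have := subrX1 (1 - Q) n.+1; rewrite -/S => E.
  by rewrite -[LHS]opprK -mulNr -(opprB _ 1) E; congr (- (_ * _)); rewrite addrAC subrr add0r.
rewrite mulrCA QS mulrBr mulr1 coefB -[RHS]subr0; congr (_ - _).
rewrite coefM big1 // => j _; rewrite coef_exp_small ?mulr0 //.
  by rewrite coefB coef1 Q0 subrr.
by rewrite ltnS leq_subr.
Qed.

Lemma has_ogf_uniq (u v : nat -> int) (P Q : {poly int}) :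
  Q`_0 = 1 -> has_ogf u P Q -> has_ogf v P Q -> u =1 v.
Proof.
move=> Q0 Hu Hv n; elim/ltn_ind: n => n IHn.
have := Hu n; rewrite -(Hv n) !big_ord_recl Q0 !mul1r subn0.
rewrite [in RHS](eq_bigr (fun i : 'I_n => Q`_(lift ord0 i) * u (n - lift ord0 i)%N)).
  exact: addIr.
by move=> i _; rewrite IHn // lift0; case: n i {IHn} => [[]//|m i];
   rewrite subSS ltnS leq_subr.
Qed.

Definition A007070 : nat -> int :=
  ogf_coef 1 (1 - 4%:R *: 'X + 2%:R *: 'X^2).

Definition A200676 : nat -> int :=
  ogf_coef (1 - 5%:R *: 'X + 3%:R *: 'X^2)
           (1 - 5%:R *: 'X + 3%:R *: 'X^2 - 'X^3).

Lemma A007070_ogf :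
  has_ogf A007070 1 (1 - 4%:R *: 'X + 2%:R *: 'X^2).
Proof. by apply: ogf_coefP; rewrite !coefE. Qed.

Lemma A200676_ogf :
  has_ogf A200676 (1 - 5%:R *: 'X + 3%:R *: 'X^2)
                  (1 - 5%:R *: 'X + 3%:R *: 'X^2 - 'X^3).
Proof. by apply: ogf_coefP; rewrite !coefE. Qed.

(* Main.v *)
Require Import Defs.
From mathcomp Require Import all_boot all_order all_algebra.
From mathcomp Require Import zify ring.

Set Implicit Arguments.
Unset Strict Implicit.
Unset Printing Implicit Defensive.

Import Order.TTheory GRing.Theory Num.Theory.
Local Open Scope ring_scope.

(** Call a word bad at a position if the letter increases there by exactly
    [s].  Let [a_n] count the words without bad positions and [g_n(i)] those of
    length [n] that can be written after the letter [i].  A word counted by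
    [a_(n+1)] starts either with a letter allowed after [i] or with the single
    forbidden letter [i + s], so
      [g_(n+1)(i) = a_(n+1) - g_n(i + s)]   if [i + s] is a letter,
      [g_(n+1)(i) = a_(n+1)]                otherwise.
    Iterating along the progression [i, i + s, i + 2s, ...] until it leaves the
    alphabet expresses [g_n(i)] as an alternating sum of the [a_(n-m)]
    ([num_words_afterE]).  Since [a_(n+1)] is the sum of the [g_n(i)], and
    [max (k - m s, 0)] letters [i] have [i + m s] in the alphabet,
      [a_(n+1) = \sum_m (-1)^m max (k - m s, 0) a_(n-m)]   ([num_words_rec]).
    For [s > 0] this says that the generating function of [a] is the inverse of
    a polynomial ([num_words_ogf]).  With [s = 2] and [k = 3, 4, 5] the
    polynomial is [1 - 3x + x^2], [1 - 4x + 2x^2] and [1 - 5x + 3x^2 - x^3].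

    A generating function [P / Q] with [Q(0) = 1] determines its coefficients,
    so it remains to see that the three sequences on the right have the
    inverses of these polynomials as generating functions.  For the third one,
    [(1 - 5x + 3x^2) / Q = 1 + x^3 / Q] when [Q = 1 - 5x + 3x^2 - x^3], hence
    dropping the first three terms [1, 0, 0] leaves [1 / Q]. *)

(** * Words according to their first letter *)

Lemma card_tuple_cons (T : finType) (n : nat) (p : pred (seq T)) :
  #|[set w : n.+1.-tuple T | p w]|
    = (\sum_(x : T) #|[set w : n.-tuple T | p (x :: w)]|)%N.
Proof.
rewrite -sum1dep_card.
rewrite (reindex (fun xw : T * n.-tuple T => [tuple of xw.1 :: xw.2])) /=.
  under [RHS]eq_bigr => x _ do rewrite -sum1dep_card.
  by rewrite (pair_big_dep predT).
exists (fun w => (thead w, [tuple of behead w])) => [[x w]|w] _ /=.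
  by congr (_, _); apply: val_inj.
by rewrite [RHS]tuple_eta.
Qed.

Lemma card_tuple0 (T : finType) (p : pred (seq T)) :
  p [::] -> #|[set w : 0.-tuple T | p w]| = 1%N.
Proof.
move=> p0; rewrite (_ : [set _ | _] = setT) ?cardsT ?card_tuple ?expn0 //.
by apply/setP => w; rewrite !inE [w]tuple0.
Qed.

Definition step_ok (k s : nat) : rel 'I_k :=
  fun x y => letter y - letter x != s%:Z.

Definition num_words_after (k s n : nat) (i : 'I_k) : nat :=
  #|[set w : n.-tuple 'I_k | path (step_ok s) i w]|.

Lemma step_okE (k s : nat) (i j : 'I_k) :
  step_ok s i j = (j != i + s :> nat)%N.
Proof. by rewrite /step_ok /letter; lia. Qed.

Lemma num_words0 (k s : nat) : num_words k s 0 = 1%N.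
Proof. exact: (@card_tuple0 _ (sorted (step_ok s))). Qed.

Lemma num_words_after0 (k s : nat) (i : 'I_k) : num_words_after s 0 i = 1%N.
Proof. exact: (@card_tuple0 _ (path (step_ok s) i)). Qed.

Lemma num_wordsS (k s n : nat) :
  num_words k s n.+1 = (\sum_(i : 'I_k) num_words_after s n i)%N.
Proof. exact: (card_tuple_cons n (sorted (step_ok s))). Qed.

Lemma num_words_afterS (k s n : nat) (i : 'I_k) :
  num_words_after s n.+1 i
    = (\sum_(j : 'I_k | j != i + s :> nat) num_words_after s n j)%N.
Proof.
rewrite /num_words_after (card_tuple_cons n (path (step_ok s) i)) [RHS]big_mkcond.
apply: eq_bigr => j _ /=; rewrite -step_okE; case: ifP => //= _.
by rewrite (_ : [set _ | _] = set0) ?cards0 //; apply/setP => w; rewrite !inE.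
Qed.

(** The closed form of [g_(n+1)(i) = a_(n+1) - g_n(i + s)]: each further
    substitution of the recurrence moves one step along the progression of
    difference [s] and flips the sign; the indicator records whether the
    progression is still inside the alphabet. *)
Lemma num_words_afterE (k s n : nat) (i : 'I_k) :
  (num_words_after s n i)%:Z
    = \sum_(m < n.+1)
        (i + m * s < k)%N%:R * ((-1) ^+ m * (num_words k s (n - m))%:Z).
Proof.
elim: n i => [|n IHn] i.
  by rewrite big_ord1 num_words_after0 num_words0 mul0n addn0 ltn_ord.
rewrite big_ord_recl mul0n addn0 ltn_ord !mul1r subn0.
(* At most one letter [j] satisfies the condition of the second sum. *)
have split_sum : (num_words k s n.+1 = num_words_after s n.+1 i +
    \sum_(j : 'I_k | j == i + s :> nat) num_words_after s n j)%N.
  by rewrite num_wordsS num_words_afterS addnC; apply: bigID.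
rewrite split_sum PoszD -addrA -[LHS]addr0; congr (_ + _); symmetry.
have [lt_isk|le_kis] := ltnP (i + s) k.
  rewrite (big_pred1 (Ordinal lt_isk)) // IHn -big_split big1 //= => m _.
  by rewrite subSS /bump /= exprS mulSn addnA; ring.
rewrite big_pred0 ?add0r => [|j]; last by have := ltn_ord j; lia.
rewrite big1 // => m _; rewrite (_ : (_ < k)%N = false) ?mul0r //.
by rewrite /= /bump /= mulSn; lia.
Qed.

(** * The generating function for every alphabet and forbidden step *)

Lemma card_add_lt (k d : nat) :
  (\sum_(i < k) (i + d < k)%N = k - d)%N.
Proof.
rewrite -[RHS]subn0 -[RHS]muln1 -sum_nat_const_nat big_mkord.
rewrite (big_ord_widen k (fun=> 1%N)) ?leq_subr // [RHS]big_mkcond.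
by apply: eq_bigr => i _; rewrite addnC -ltn_subRL; case: (_ < _)%N.
Qed.

Lemma num_words_rec (k s n : nat) :
  (num_words k s n.+1)%:Z
    = \sum_(m < n.+1)
        (k - m * s)%N%:R * ((-1) ^+ m * (num_words k s (n - m))%:Z).
Proof.
rewrite num_wordsS (big_morph Posz PoszD (erefl _)).
under eq_bigr => i _ do rewrite num_words_afterE.
rewrite exchange_big; apply: eq_bigr => m _ /=.
by rewrite -mulr_suml -natr_sum card_add_lt.
Qed.

(** Up to the sign [(-1)^j], the coefficient of [x^j] is the number of words of
    length [j] all of whose steps equal [s]: such a word is given by its first
    letter, with [j - 1] steps to fit into the alphabet.  Cutting at [j = k]
    loses nothing when [s > 0] ([coef_chain_polyS]). *)
Definition chain_poly (k s : nat) : {poly int} :=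
  \poly_(j < k.+1)
    (if j is m.+1 then (-1) ^+ m.+1 * (k - m * s)%N%:R else 1).

Lemma chain_poly_coef0 (k s : nat) : (chain_poly k s)`_0 = 1.
Proof. by rewrite coef_poly. Qed.

Lemma coef_chain_polyS (k s m : nat) : (0 < s)%N ->
  (chain_poly k s)`_m.+1 = (-1) ^+ m.+1 * (k - m * s)%N%:R.
Proof.
move=> s_gt0; rewrite coef_poly ltnS; case: ltnP => // le_km.
suff -> : (k - m * s = 0)%N by rewrite mulr0.
by apply/eqP; rewrite subn_eq0 (leq_trans le_km) ?leq_pmulr.
Qed.

Lemma num_words_ogf (k s : nat) : (0 < s)%N ->
  has_ogf (fun n => (num_words k s n)%:Z) 1 (chain_poly k s).
Proof.
move=> s_gt0 [|n]; rewrite coef1 big_ord_recl chain_poly_coef0 mul1r subn0.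
  by rewrite big_ord0 num_words0.
rewrite num_words_rec -big_split big1 //= => m _.
by rewrite /bump /= coef_chain_polyS // subSS exprS; ring.
Qed.

(** * The three sequences *)

(** If [u = P' / Q] with [P' = c Q + x P], then [u = c + x (P / Q)], so that
    removing the constant term [c] and dividing by [x] leaves [P / Q]. *)
Lemma has_ogf_tail (u : nat -> int) (c : int) (P Q : {poly int}) : Q`_0 = 1 ->
  has_ogf u (c *: Q + 'X * P) Q -> has_ogf (fun n => u n.+1) P Q.
Proof.
move=> Q0 uQ.
have u0 : u 0%N = c.
  by have := uQ 0%N; rewrite big_ord1 coefD coefZ coefXM Q0 mul1r mulr1 addr0.
move=> n; have := uQ n.+1.
rewrite big_ord_recr subnn u0 coefD coefZ coefXM /= [_ * c]mulrC addrC.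
move/addrI => <-; apply: eq_bigr => i _.
by rewrite subSn // -ltnS.
Qed.

(** Every other Fibonacci number satisfies
    [F_(m+4) = 3 F_(m+2) - F_m], whence the denominator. *)
Lemma fib_even_ogf :
  has_ogf (fun n => (fib (2 * n + 2))%:Z) 1 (1 - 3%:R *: 'X + 'X^2).
Proof.
case=> [|[|n]].
- by rewrite big_ord1 !coefE.
- by rewrite !big_ord_recl big_ord0 !coefE.
rewrite 3!big_ord_recl big1 => [|i _]; last by rewrite !coefE /= mul0r.
rewrite !lift0 !subSS !subn0 !coefE.
have -> : (2 * n.+2 + 2 = (2 * n + 2).+4)%N by lia.
have -> : (2 * n.+1 + 2 = (2 * n + 2).+2)%N by lia.
by move: (2 * n + 2)%N => p /=; lia.
Qed.

Lemma chain_poly32 : chain_poly 3 2 = 1 - 3%:R *: 'X + 'X^2.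
Proof. by apply/polyP => -[|[|[|[|j]]]]; rewrite coef_poly !coefE. Qed.

Lemma chain_poly42 : chain_poly 4 2 = 1 - 4%:R *: 'X + 2%:R *: 'X^2.
Proof. by apply/polyP => -[|[|[|[|[|j]]]]]; rewrite coef_poly !coefE. Qed.

Lemma chain_poly52 :
  chain_poly 5 2 = 1 - 5%:R *: 'X + 3%:R *: 'X^2 - 'X^3.
Proof. by apply/polyP => -[|[|[|[|[|[|j]]]]]]; rewrite coef_poly !coefE. Qed.

(** With [Q] this polynomial, the numerator [1 - 5x + 3x^2] is [Q + x^3], so
    the first three terms removed are [1, 0, 0]. *)
Lemma A200676_shift_ogf :
  has_ogf (fun n => A200676 n.+3) 1 (chain_poly 5 2).
Proof.
have Q0 := chain_poly_coef0 5 2.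
apply: (@has_ogf_tail (fun n => A200676 n.+2) 0) => //.
apply: (@has_ogf_tail (fun n => A200676 n.+1) 0) => //.
apply: (@has_ogf_tail A200676 1) => //.
rewrite scale1r !scale0r !add0r mulr1 chain_poly52.
have -> : 'X * ('X * 'X) = 'X^3 :> {poly int} by rewrite -expr2 -exprS.
by rewrite subrK; apply: A200676_ogf.
Qed.

Theorem corollary3p1 :
  forall n : nat,
    [/\ num_words 3 2 n = fib (2 * n + 2)%N,
        Posz (num_words 4 2 n) = A007070 n
      & Posz (num_words 5 2 n) = A200676 (n + 3)%N].
Proof.
move=> n.
have word_ogf k := @num_words_ogf k 2 isT.
split.
- have := word_ogf 3; rewrite chain_poly32 => word3.
  apply/eqP; rewrite -eqz_nat; apply/eqP.
  by apply: (has_ogf_uniq _ word3 fib_even_ogf); rewrite !coefE.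
- have := word_ogf 4; rewrite chain_poly42 => word4.
  by apply: (has_ogf_uniq _ word4 A007070_ogf); rewrite !coefE.
rewrite addn3.
exact: (has_ogf_uniq (chain_poly_coef0 5 2) (word_ogf 5) A200676_shift_ogf).
Qed.
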